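(* Let $\sigma\in(-1,0)$ and let $F(a,b)=\operatorname{sgn}(\sigma)\,H^{\sigma}=-(a+b)^{\sigma}$ for $a,b>0$, where $H=a+b$. Then $$w(a,b)=\frac{(a-b)^2(a^2+b^2)(ab)^{\sigma-2}}{a+b}$$ is a maximum-principle function (MPF) for the normal velocity $F$.
   Context: Notation: $\mathbb{R}^2_+=(0,\infty)^2$; subscripts $a,b$ denote partial derivatives. Normal velocity: a symmetric function $F\in C^2(\mathbb{R}^2_+)$, homogeneous of some degree $\sigma\in\mathbb{R}\setminus\{0\}$, with $F_a,F_b>0$ for all $a,b>0$. It is contracting if $F>0$ everywhere on $\mathbb{R}^2_+$ and expanding if $F<0$ everywhere on $\mathbb{R}^2_+$. Maximum-principle function (MPF) for a normal velocity $F$: a symmetric function $w\in C^2(\mathbb{R}^2_+)$, homogeneous of some degree $\chi\in\mathbb{R}\setminus\{0\}$, such that, with $\alpha=-w_a/w_b$ and $\alpha_a=\partial\alpha/\partial a$ (defined for $a\ne b$): (1) $w>0$ whenever $a\neq b$, and $w=0$ whenever $a=b$. (2) $\chi>0$ if $F$ is contracting, $\chi<0$ if $F$ is expanding. (3) $w_a<0$ for all $0<a<b$, and $w_a>0$ for all $0<b<a$. (4) For all $a,b>0$ (for $E_w,G_w$: $a\neq b$) one has $C_w(a,b)\le0$, $E_w(a,b)\le0$, $G_w(a,b)\le 0$, where $$C_w=w_a\,a\big((F_aa^2+F_bb^2)+(F-F_aa-F_bb)a\big)+w_b\,b\big((F_aa^2+F_bb^2)+(F-F_aa-F_bb)b\big),$$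 $$E_w=w_a(F_{aa}+2F_{ab}\alpha+F_{bb}\alpha^2)-F_a(w_{aa}+2w_{ab}\alpha+w_{bb}\alpha^2)+2\,\frac{w_bF_a-w_aF_b}{a-b}\,\alpha^2,$$ $$G_w=\frac1{\alpha^2}\Big(w_b(F_{aa}+2F_{ab}\alpha+F_{bb}\alpha^2)-F_b(w_{aa}+2w_{ab}\alpha+w_{bb}\alpha^2)+2\,\frac{w_bF_a-w_aF_b}{a-b}\Big).$$ (5) There are constants $c>0$, $d\in\mathbb{R}$ such that, evaluating $\alpha$ and $\alpha_a$ at $(a,b)=(\rho,1)$ with $0<\rho<1$: if $F$ is contracting, then either $\alpha=c$ and $\alpha_a=0$ for all sufficiently small $\rho$, or, as $\rho\to0$, $\alpha=\frac c\rho+o(\rho^{-1})$ and $\alpha_a=-\frac c{\rho^2}+o(\rho^{-1})$; if $F$ is expanding, then, as $\rho\to0$, either $\alpha=\frac c\rho+o(\rho^{-1})$ and $\alpha_a=-\frac c{\rho^2}+o(\rho^{-1})$, or $\alpha=\frac{c+d\rho}{\rho^2}+o(\rho^{-1})$ and $\alpha_a=-\frac{2c+d\rho}{\rho^3}+o(\rho^{-1})$. *)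

(* Defs.v *)
From Stdlib Require Import Reals.
From Coquelicot Require Import Coquelicot.
Open Scope R_scope.

(* Functions on the open quadrant are total functions [R -> R -> R]; every
   condition below only involves points with positive coordinates. *)

Definition Da (f : R -> R -> R) : R -> R -> R :=
  fun a b => Derive (fun x => f x b) a.
Definition Db (f : R -> R -> R) : R -> R -> R :=
  fun a b => Derive (fun y => f a y) b.

(* [ex_diff_n f 2 a b] says that the partial derivatives of [f] of order at
   most 2 exist at (a, b) and are continuous there. *)
Definition C2_quadrant (f : R -> R -> R) : Prop :=
  forall a b, 0 < a -> 0 < b -> ex_diff_n f 2 a b.

Definition symmetric_quadrant (f : R -> R -> R) : Prop :=
  forall a b, 0 < a -> 0 < b -> f a b = f b a.

Definition homogeneous_quadrant (f : R -> R -> R) (k : R) : Prop :=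
  forall t a b, 0 < t -> 0 < a -> 0 < b ->
    f (t * a) (t * b) = Rpower t k * f a b.

Definition normal_velocity (F : R -> R -> R) : Prop :=
  C2_quadrant F /\
  symmetric_quadrant F /\
  (exists sigma, sigma <> 0 /\ homogeneous_quadrant F sigma) /\
  (forall a b, 0 < a -> 0 < b -> 0 < Da F a b /\ 0 < Db F a b).

Definition contracting (F : R -> R -> R) : Prop :=
  forall a b, 0 < a -> 0 < b -> 0 < F a b.

Definition expanding (F : R -> R -> R) : Prop :=
  forall a b, 0 < a -> 0 < b -> F a b < 0.

Definition alpha (w : R -> R -> R) : R -> R -> R :=
  fun a b => - Da w a b / Db w a b.

Definition Cw (F w : R -> R -> R) (a b : R) : R :=
  let Fa := Da F a b in
  let Fb := Db F a b in
  Da w a b * a *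
    ((Fa * a ^ 2 + Fb * b ^ 2) + (F a b - Fa * a - Fb * b) * a)
  + Db w a b * b *
    ((Fa * a ^ 2 + Fb * b ^ 2) + (F a b - Fa * a - Fb * b) * b).

Definition second_order (f : R -> R -> R) (al a b : R) : R :=
  Da (Da f) a b + 2 * Db (Da f) a b * al + Db (Db f) a b * al ^ 2.

Definition Ew (F w : R -> R -> R) (a b : R) : R :=
  let al := alpha w a b in
  Da w a b * second_order F al a b
  - Da F a b * second_order w al a b
  + 2 * ((Db w a b * Da F a b - Da w a b * Db F a b) / (a - b)) * al ^ 2.

Definition Gw (F w : R -> R -> R) (a b : R) : R :=
  let al := alpha w a b in
  / al ^ 2 *
  (Db w a b * second_order F al a b
   - Db F a b * second_order w al a b
   + 2 * ((Db w a b * Da F a b - Da w a b * Db F a b) / (a - b))).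

(* f rho = g rho + o(1 / rho) as rho tends to 0 from the right;
   Coquelicot's [is_domin F u v] reads v = o(u) along the filter F. *)
Definition eq_up_to_o_inv (f g : R -> R) : Prop :=
  is_domin (at_right 0) (fun rho : R => / rho) (fun rho : R => f rho - g rho).

Definition asymptotics (F w : R -> R -> R) : Prop :=
  let al := fun rho : R => alpha w rho 1 in
  let al_a := fun rho : R => Da (alpha w) rho 1 in
  exists c d : R, 0 < c /\
    (contracting F ->
       at_right 0 (fun rho : R => al rho = c /\ al_a rho = 0)
       \/
       (eq_up_to_o_inv al (fun rho => c / rho) /\
        eq_up_to_o_inv al_a (fun rho => - (c / rho ^ 2)))) /\
    (expanding F ->
       (eq_up_to_o_inv al (fun rho => c / rho) /\
        eq_up_to_o_inv al_a (fun rho => - (c / rho ^ 2)))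
       \/
       (eq_up_to_o_inv al (fun rho => (c + d * rho) / rho ^ 2) /\
        eq_up_to_o_inv al_a (fun rho => - ((2 * c + d * rho) / rho ^ 3)))).

Record is_MPF (F w : R -> R -> R) : Prop := {
  MPF_velocity : normal_velocity F;
  MPF_C2 : C2_quadrant w;
  MPF_sym : symmetric_quadrant w;
  MPF_homogeneous : exists chi, chi <> 0 /\ homogeneous_quadrant w chi /\
    (contracting F -> 0 < chi) /\ (expanding F -> chi < 0);
  MPF_pos : forall a b, 0 < a -> 0 < b -> a <> b -> 0 < w a b;
  MPF_zero : forall a, 0 < a -> w a a = 0;
  MPF_decr : forall a b, 0 < a -> a < b -> Da w a b < 0;
  MPF_incr : forall a b, 0 < b -> b < a -> 0 < Da w a b;
  MPF_Cw : forall a b, 0 < a -> 0 < b -> Cw F w a b <= 0;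
  MPF_Ew : forall a b, 0 < a -> 0 < b -> a <> b -> Ew F w a b <= 0;
  MPF_Gw : forall a b, 0 < a -> 0 < b -> a <> b -> Gw F w a b <= 0;
  MPF_asymptotics : asymptotics F w
}.

(* Main.v *)
(** Writing [H = a + b] and [K = (a b)^(sigma - 2)], one finds
    [w_a = (a - b) K P(a, b) / (a H^2)] with a quartic form [P] which is positive
    on the quadrant, and [w_b] follows by symmetry; hence
    [alpha = b P(a, b) / (a P(b, a))] is rational.  Up to a positive factor,
    [C_w] and [E_w] are then binary forms in [(a, b)] with coefficients
    polynomial in [sigma], and these are bounded above by forms which are
    nonpositive by weighted AM-GM; [G_w (a, b) = E_w (b, a)] since [alpha]
    becomes [1 / alpha] under the exchange.  Finally
    [alpha (rho, 1) = c / rho + O(1)] with [c = P(0, 1) / P(1, 0)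
    = (2 - sigma) / (1 + sigma)], which is positive since [-1 < sigma < 0]. *)

Require Import Defs.
From Stdlib Require Import Reals Lra.
From Coquelicot Require Import Coquelicot.
Open Scope R_scope.

(** * Partial derivatives and C^2 regularity on the open quadrant *)

(** Second partials are [Derive] of a first partial whose formula is known only at positive
    arguments; this suffices because [Derive] is local. *)
Lemma Derive_positive_ext (f g : R -> R) (x l : R) :
  0 < x -> (forall t, 0 < t -> f t = g t) -> is_derive g x l ->
  Derive f x = l.
Proof.
intros hx e h; apply is_derive_unique.
apply is_derive_ext_loc with (2 := h).
apply (locally_interval _ x 0 p_infty); simpl; auto.
intros t ht _; symmetry; now apply e.
Qed.

(** Explicit candidates stand in for the nested [Derive] terms of [ex_diff_n]; each agrees with its
    candidate on the open quadrant, hence near every point of it. Both orders of mixed partials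
    occur in [ex_diff_n]. *)
Lemma C2_quadrant_intro (f fa fb faa fab fba fbb : R -> R -> R) :
  (forall a b, 0 < a -> 0 < b ->
     is_derive (fun x => f x b) a (fa a b) /\
     is_derive (fun y => f a y) b (fb a b) /\
     is_derive (fun x => fa x b) a (faa a b) /\
     is_derive (fun y => fa a y) b (fab a b) /\
     is_derive (fun x => fb x b) a (fba a b) /\
     is_derive (fun y => fb a y) b (fbb a b)) ->
  (forall a b, 0 < a -> 0 < b ->
     continuity_2d_pt f a b /\
     continuity_2d_pt fa a b /\ continuity_2d_pt fb a b /\
     continuity_2d_pt faa a b /\ continuity_2d_pt fab a b /\
     continuity_2d_pt fba a b /\ continuity_2d_pt fbb a b) ->
  C2_quadrant f.
Proof.
intros hd hc.
assert (ext : forall g h a b, 0 < a -> 0 < b ->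
   (forall x y, 0 < x -> 0 < y -> h x y = g x y) ->
   continuity_2d_pt g a b -> continuity_2d_pt h a b).
{ intros g h a b ha hb e; apply continuity_2d_pt_ext_loc.
  (* The square of radius min(a, b) around (a, b) stays inside the quadrant. *)
  exists (mkposreal _ (Rmin_pos _ _ ha hb)); simpl; intros u v hu hv.
  apply Rabs_def2 in hu; apply Rabs_def2 in hv.
  pose proof (Rmin_l a b); pose proof (Rmin_r a b).
  symmetry; apply e; lra. }
assert (ea : forall x y, 0 < x -> 0 < y -> Derive (fun z => f z y) x = fa x y)
  by (intros; apply is_derive_unique; now apply hd).
assert (eb : forall x y, 0 < x -> 0 < y -> Derive (fun z => f x z) y = fb x y)
  by (intros; apply is_derive_unique; now apply hd).
assert (loc : forall (g h : R -> R) x l, 0 < x ->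
   (forall t, 0 < t -> h t = g t) -> is_derive g x l -> ex_derive h x).
{ intros g h x l hx e hg; exists l.
  apply is_derive_ext_loc with (2 := hg).
  apply (locally_interval _ x 0 p_infty); simpl; auto.
  intros t ht _; symmetry; now apply e. }
intros a b ha hb.
destruct (hd a b ha hb) as (da & db & daa & dab & dba & dbb).
destruct (hc a b ha hb) as (c & ca & cb & caa & cab & cba & cbb).
simpl; repeat split; auto; try (eexists; eassumption).
- now apply (ext fa).
- now apply (loc (fun x => fa x b) _ _ (faa a b)); auto.
- now apply (loc (fun y => fa a y) _ _ (fab a b)); auto.
- apply (ext faa); auto; intros x y hx hy.
  apply (Derive_positive_ext _ (fun x => fa x y)); auto; now apply hd.
- apply (ext fab); auto; intros x y hx hy.
  apply (Derive_positive_ext _ (fun y => fa x y)); auto; now apply hd.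
- now apply (ext fb).
- now apply (loc (fun x => fb x b) _ _ (fba a b)); auto.
- now apply (loc (fun y => fb a y) _ _ (fbb a b)); auto.
- apply (ext fba); auto; intros x y hx hy.
  apply (Derive_positive_ext _ (fun x => fb x y)); auto; now apply hd.
- apply (ext fbb); auto; intros x y hx hy.
  apply (Derive_positive_ext _ (fun y => fb x y)); auto; now apply hd.
Qed.

Lemma continuity_2d_pt_pow (f : R -> R -> R) (n : nat) (a b : R) :
  continuity_2d_pt f a b -> continuity_2d_pt (fun x y => f x y ^ n) a b.
Proof.
intros h; apply (continuity_1d_2d_pt_comp (fun t => t ^ n)); auto.
apply derivable_continuous_pt, derivable_pt_pow.
Qed.

Lemma continuity_2d_pt_Rpower (f : R -> R -> R) (k a b : R) :
  0 < f a b -> continuity_2d_pt f a b ->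
  continuity_2d_pt (fun x y => Rpower (f x y) k) a b.
Proof.
intros p h; apply (continuity_1d_2d_pt_comp (fun t => Rpower t k)); auto.
apply derivable_continuous_pt; eexists; now apply derivable_pt_lim_power.
Qed.

Lemma Rpower_sub1 (x k : R) : 0 < x -> Rpower x (k - 1) = Rpower x k / x.
Proof.
intros; unfold Rminus; rewrite Rpower_plus, Rpower_Ropp, Rpower_1; auto.
Qed.

Lemma Rpower_pos (x k : R) : 0 < Rpower x k.
Proof. apply exp_pos. Qed.

Ltac continuity_2d :=
  unfold Rdiv;
  repeat first
    [ apply continuity_2d_pt_const | apply continuity_2d_pt_id1
    | apply continuity_2d_pt_id2 | apply continuity_2d_pt_opp
    | apply continuity_2d_pt_plus | apply continuity_2d_pt_minus
    | apply continuity_2d_pt_mult | apply continuity_2d_pt_pow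
    | apply continuity_2d_pt_inv | apply continuity_2d_pt_Rpower ].


(** * Derivatives of F *)

Lemma is_derive_F (s a b : R) :
  0 < a -> 0 < b ->
  is_derive (fun x => - Rpower (x + b) s) a (- s * Rpower (a + b) (s - 1)) /\
  is_derive (fun y => - Rpower (a + y) s) b (- s * Rpower (a + b) (s - 1)) /\
  is_derive (fun x => - s * Rpower (x + b) (s - 1)) a
    (s * (1 - s) * Rpower (a + b) (s - 2)) /\
  is_derive (fun y => - s * Rpower (a + y) (s - 1)) b
    (s * (1 - s) * Rpower (a + b) (s - 2)).
Proof.
intros ha hb.
(* Every power is reduced to exponent [s], so that [field] meets a single exponential after
   differentiation. *)
replace (s - 2) with (s - 1 - 1) by ring.
rewrite (Rpower_sub1 _ (s - 1)), (Rpower_sub1 _ s) by lra.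
split; [ | split; [ | split ] ].
- unfold Rpower; auto_derive; [lra | field; lra].
- unfold Rpower; auto_derive; [lra | field; lra].
- apply is_derive_ext_loc with (fun x => - s * (Rpower (x + b) s / (x + b))).
  { apply (locally_interval _ a 0 p_infty); simpl; auto.
    intros; rewrite Rpower_sub1 by lra; reflexivity. }
  unfold Rpower; auto_derive; [lra | field; lra].
- apply is_derive_ext_loc with (fun y => - s * (Rpower (a + y) s / (a + y))).
  { apply (locally_interval _ b 0 p_infty); simpl; auto.
    intros; rewrite Rpower_sub1 by lra; reflexivity. }
  unfold Rpower; auto_derive; [lra | field; lra].
Qed.

(** * First and second derivatives of w *)

Definition w_fun (s a b : R) : R :=
  (a - b) ^ 2 * (a ^ 2 + b ^ 2) * Rpower (a * b) (s - 2) / (a + b).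

Definition wP (s a b : R) : R :=
  (1 + s) * a ^ 4 + 3 * a ^ 3 * b - a ^ 2 * b ^ 2 + 3 * a * b ^ 3
  + (2 - s) * b ^ 4.

Definition wA (s a b : R) : R :=
  (a - b) * Rpower (a * b) (s - 2) * wP s a b / (a * (a + b) ^ 2).

(** Numerator of w_aa over the denominator of [wAA]. Its three summands come from differentiating K
    / a, (a - b) P and (a + b)^(-2) in turn; [wTab] is built likewise for w_ab. *)
Definition wTaa (s a b : R) : R :=
  (s - 3) * ((a - b) * wP s a b) * (a + b)
  + a * ((4 * (1 + s) * a ^ 3 + 9 * a ^ 2 * b - 2 * a * b ^ 2 + 3 * b ^ 3)
         * (a - b) + wP s a b) * (a + b)
  - 2 * a * ((a - b) * wP s a b).

Definition wTab (s a b : R) : R :=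
  (s - 2) * ((a - b) * wP s a b) * (a + b)
  + b * ((3 * a ^ 3 - 2 * a ^ 2 * b + 9 * a * b ^ 2 + 4 * (2 - s) * b ^ 3)
         * (a - b) - wP s a b) * (a + b)
  - 2 * b * ((a - b) * wP s a b).

Definition wAA (s a b : R) : R :=
  Rpower (a * b) (s - 2) * wTaa s a b / (a ^ 2 * (a + b) ^ 3).

Definition wAB (s a b : R) : R :=
  Rpower (a * b) (s - 2) * wTab s a b / (a * b * (a + b) ^ 3).

Lemma w_fun_sym (s a b : R) : w_fun s a b = w_fun s b a.
Proof.
unfold w_fun; rewrite (Rmult_comm b a), (Rplus_comm b a), (Rplus_comm (b ^ 2)).
now replace ((b - a) ^ 2) with ((a - b) ^ 2) by ring.
Qed.

Lemma is_derive_w_a (s a b : R) :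
  0 < a -> 0 < b -> is_derive (fun x => w_fun s x b) a (wA s a b).
Proof.
intros ha hb; unfold w_fun, wA, wP, Rpower; auto_derive.
- split; [now apply Rmult_lt_0_compat | lra].
- field; lra.
Qed.

Lemma is_derive_w_b (s a b : R) :
  0 < a -> 0 < b -> is_derive (fun y => w_fun s a y) b (wA s b a).
Proof.
intros ha hb; apply is_derive_ext with (fun y => w_fun s y a).
- intros; apply w_fun_sym.
- now apply is_derive_w_a.
Qed.

Lemma is_derive_wA_a (s a b : R) :
  0 < a -> 0 < b -> is_derive (fun x => wA s x b) a (wAA s a b).
Proof.
intros ha hb; unfold wA, wAA, wTaa, wP, Rpower; auto_derive.
- repeat split; try now apply Rmult_lt_0_compat.
  apply Rgt_not_eq; simpl; rewrite Rmult_1_r.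
  repeat apply Rmult_lt_0_compat; lra.
- field; lra.
Qed.

Lemma is_derive_wA_b (s a b : R) :
  0 < a -> 0 < b -> is_derive (fun y => wA s a y) b (wAB s a b).
Proof.
intros ha hb; unfold wA, wAB, wTab, wP, Rpower; auto_derive.
- repeat split; try now apply Rmult_lt_0_compat.
  apply Rgt_not_eq; simpl; rewrite Rmult_1_r.
  repeat apply Rmult_lt_0_compat; lra.
- field; lra.
Qed.

Lemma wAB_sym (s a b : R) : 0 < a -> 0 < b -> wAB s a b = wAB s b a.
Proof.
intros; unfold wAB, wTab, wP; rewrite (Rmult_comm b a); field; lra.
Qed.

(** * Positivity of P and sign of the numerator of E_w *)

(** The outer coefficients 1 + s and 2 - s are positive, and the inner terms are a b times the
    positive definite form 3 a^2 - a b + 3 b^2. *)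
Lemma wP_pos (s a b : R) : -1 < s < 0 -> 0 < a -> 0 < b -> 0 < wP s a b.
Proof.
intros hs ha hb; unfold wP.
assert (0 < a * b) by now apply Rmult_lt_0_compat.
assert (0 < (1 + s) * a ^ 4) by (apply Rmult_lt_0_compat; [lra | now apply pow_lt]).
assert (0 < (2 - s) * b ^ 4) by (apply Rmult_lt_0_compat; [lra | now apply pow_lt]).
nra.
Qed.

(* The numerator of [Ew], see [wE_factor]; at [s = -1] its coefficients of
   [a ^ 13] and [a ^ 12 * b] vanish, so these must be bounded by multiples of
   [1 + s]. *)
Definition wE (s a b : R) : R :=
  (-2 + s - 2 * s ^ 3 + s ^ 4) * a ^ 13
  + (-12 - 14 * s + 12 * s ^ 2 + 9 * s ^ 3 - 5 * s ^ 4) * (a ^ 12 * b)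
  + (-48 + 10 * s - 10 * s ^ 2 - 20 * s ^ 3 + 12 * s ^ 4) * (a ^ 11 * b ^ 2)
  + (-28 - 78 * s + 10 * s ^ 2 + 40 * s ^ 3 - 20 * s ^ 4) * (a ^ 10 * b ^ 3)
  + (-78 + 23 * s + 38 * s ^ 2 - 74 * s ^ 3 + 25 * s ^ 4) * (a ^ 9 * b ^ 4)
  + (-160 + 24 * s - 74 * s ^ 2 + 105 * s ^ 3 - 21 * s ^ 4) * (a ^ 8 * b ^ 5)
  + (-104 - 100 * s + 28 * s ^ 2 - 120 * s ^ 3 + 8 * s ^ 4) * (a ^ 7 * b ^ 6)
  + (-136 + 116 * s - 28 * s ^ 2 + 112 * s ^ 3 + 8 * s ^ 4) * (a ^ 6 * b ^ 7)
  + (-166 - 17 * s - 20 * s ^ 2 - 70 * s ^ 3 - 21 * s ^ 4) * (a ^ 5 * b ^ 8)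
  + (-108 - 46 * s + 56 * s ^ 2 + 19 * s ^ 3 + 25 * s ^ 4) * (a ^ 4 * b ^ 9)
  + (-72 + 58 * s - 18 * s ^ 2 + 12 * s ^ 3 - 20 * s ^ 4) * (a ^ 3 * b ^ 10)
  + (-60 - 6 * s + 18 * s ^ 2 - 24 * s ^ 3 + 12 * s ^ 4) * (a ^ 2 * b ^ 11)
  + (-42 + 25 * s - 18 * s ^ 2 + 18 * s ^ 3 - 5 * s ^ 4) * (a * b ^ 12)
  + (-8 + 4 * s + 6 * s ^ 2 - 5 * s ^ 3 + s ^ 4) * b ^ 13.

(** The coefficients are first bounded above, free of [s] beyond the two leading ones; the positive
    monomials left are then absorbed by neighbouring negative ones. *)
Lemma wE_nonpos (s a b : R) : -1 < s < 0 -> 0 < a -> 0 < b -> wE s a b <= 0.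
Proof.
intros hs ha hb.
(* Every bound on a coefficient below, as a polynomial of degree 4 in [s],
   has nonnegative coordinates in this Bernstein basis of [[-1, 0]]. *)
assert (bern : forall i j, 0 <= (- s) ^ i * (1 + s) ^ j)
  by (intros; apply Rmult_le_pos; apply pow_le; lra).
assert (b0 := bern 0%nat 4%nat); assert (b1 := bern 1%nat 3%nat).
assert (b2 := bern 2%nat 2%nat); assert (b3 := bern 3%nat 1%nat).
assert (b4 := bern 4%nat 0%nat); clear bern.
assert (mono : forall c d m, c <= d -> 0 < m -> c * m <= d * m)
  by (intros; apply Rmult_le_compat_r; lra).
assert (pa := fun n => pow_lt a n ha); assert (pb := fun n => pow_lt b n hb).
assert (pab := fun m n => Rmult_lt_0_compat _ _ (pa m) (pb n)).
assert (pa1b := fun m => Rmult_lt_0_compat _ _ (pa m) hb).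
assert (pab1 := fun n => Rmult_lt_0_compat _ _ ha (pb n)).
apply Rle_trans with (-2 * (1 + s) * a ^ 13 + 9 * (1 + s) * (a ^ 12 * b)
  + -36 * (a ^ 11 * b ^ 2) + 26 * (a ^ 10 * b ^ 3) + 36 * (a ^ 9 * b ^ 4)
  + -160 * (a ^ 8 * b ^ 5) + 160 * (a ^ 7 * b ^ 6) + -136 * (a ^ 6 * b ^ 7)
  + 0 * (a ^ 5 * b ^ 8) + 0 * (a ^ 4 * b ^ 9) + 0 * (a ^ 3 * b ^ 10)
  + 0 * (a ^ 2 * b ^ 11) + 0 * (a * b ^ 12) + 0 * b ^ 13).
{ unfold wE; repeat apply Rplus_le_compat; apply mono; auto; lra. }
clear b0 b1 b2 b3 b4 mono.
(* Eight times the quadratic factor is (4 a - 9 b)^2 + 7 b^2. *)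
assert (h12 : 0 <= (1 + s) * (a ^ 11 * (2 * a ^ 2 - 9 * a * b + 11 * b ^ 2))).
{ apply Rmult_le_pos; [lra | apply Rmult_le_pos; [now apply Rlt_le | ]];
  pose proof (pow2_ge_0 (4 * a - 9 * b)); pose proof (pow2_ge_0 b); lra. }
assert (h11 : 0 <= - s * (a ^ 11 * b ^ 2))
  by (apply Rlt_le, Rmult_lt_0_compat; [lra | apply pab]).
(* With b = 1 the cubic is minimal at a = 4/3; removing this double root leaves 11/27 b^3. In [h9]
   the minimum is at 2 / sqrt 3, approximated by 6/5. *)
assert (h10 : 0 <= a ^ 8 * b ^ 2 * (a ^ 3 / 2 + b ^ 3 - a ^ 2 * b)).
{ apply Rmult_le_pos; [now apply Rlt_le | ].
  assert (0 <= (a / 2 + b / 3) * (a - 4 / 3 * b) ^ 2)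
    by (apply Rmult_le_pos; [lra | apply pow2_ge_0]).
  pose proof (pb 3%nat); lra. }
assert (h9 : 0 <= a ^ 8 * b ^ 2 * (a ^ 3 / 4 + b ^ 3 - a * b ^ 2)).
{ apply Rmult_le_pos; [now apply Rlt_le | ].
  assert (0 <= (a / 4 + 3 / 5 * b) * (a - 6 / 5 * b) ^ 2)
    by (apply Rmult_le_pos; [lra | apply pow2_ge_0]).
  pose proof (pb 3%nat); pose proof (pab1 2%nat); lra. }
assert (h7 : 0 <= a ^ 6 * b ^ 5 * (a - b) ^ 2)
  by (apply Rmult_le_pos; [now apply Rlt_le | apply pow2_ge_0]).
assert (h8 := pab 8%nat 5%nat); assert (h6 := pab 6%nat 7%nat).
assert (h11' := pab 11%nat 2%nat).
(* One certificate adds [h12], 11 [h11], 26 [h10], 36 [h9] and 80 [h7]; what remains is -3 a^11 b^2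
   - 18 a^8 b^5 - 56 a^6 b^7. *)
lra.
Qed.

(** * Closed forms of E_w, G_w and C_w *)

Definition vF (s a b : R) : R := - Rpower (a + b) s.

(** F depends on a + b only, so its second partials coincide and yield the square of 1 + al. First
    partials are also written with exponent s - 2, the common factor in E_w and C_w. *)
Lemma F_derivatives (s a b : R) :
  0 < a -> 0 < b ->
  Da (vF s) a b = - s * ((a + b) * Rpower (a + b) (s - 2)) /\
  Db (vF s) a b = - s * ((a + b) * Rpower (a + b) (s - 2)) /\
  forall al, second_order (vF s) al a b
             = s * (1 - s) * Rpower (a + b) (s - 2) * (1 + al) ^ 2.
Proof.
intros ha hb.
assert (da : forall x y, 0 < x -> 0 < y ->
  Da (vF s) x y = - s * Rpower (x + y) (s - 1))
  by (intros; apply is_derive_unique; now apply is_derive_F).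
assert (db : forall x y, 0 < x -> 0 < y ->
  Db (vF s) x y = - s * Rpower (x + y) (s - 1))
  by (intros; apply is_derive_unique; now apply is_derive_F).
assert (e : Rpower (a + b) (s - 1) = (a + b) * Rpower (a + b) (s - 2)).
{ replace (s - 2) with (s - 1 - 1) by ring.
  rewrite (Rpower_sub1 _ (s - 1)) by lra; field; lra. }
rewrite <- e; repeat split; auto; intros al; unfold second_order.
destruct (is_derive_F s a b ha hb) as (_ & _ & haa & hbb).
assert (Da (Da (vF s)) a b = s * (1 - s) * Rpower (a + b) (s - 2)) as ->
  by exact (Derive_positive_ext _ _ _ _ ha (fun t ht => da t b ht hb) haa).
assert (Db (Da (vF s)) a b = s * (1 - s) * Rpower (a + b) (s - 2)) as ->
  by exact (Derive_positive_ext _ _ _ _ hb (fun t ht => da a t ha ht) hbb).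
assert (Db (Db (vF s)) a b = s * (1 - s) * Rpower (a + b) (s - 2)) as ->
  by exact (Derive_positive_ext _ _ _ _ hb (fun t ht => db a t ha ht) hbb).
ring.
Qed.

Lemma Da_w (s a b : R) : 0 < a -> 0 < b -> Da (w_fun s) a b = wA s a b.
Proof. intros; apply is_derive_unique; now apply is_derive_w_a. Qed.

Lemma Db_w (s a b : R) : 0 < a -> 0 < b -> Db (w_fun s) a b = wA s b a.
Proof. intros; apply is_derive_unique; now apply is_derive_w_b. Qed.

Lemma second_order_w (s al a b : R) :
  0 < a -> 0 < b ->
  second_order (w_fun s) al a b
  = wAA s a b + 2 * wAB s a b * al + wAA s b a * al ^ 2.
Proof.
intros ha hb; unfold second_order.
assert (Da (Da (w_fun s)) a b = wAA s a b) as ->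
  by exact (Derive_positive_ext _ _ _ _ ha (fun t ht => Da_w s t b ht hb)
              (is_derive_wA_a s a b ha hb)).
assert (Db (Da (w_fun s)) a b = wAB s a b) as ->
  by exact (Derive_positive_ext _ _ _ _ hb (fun t ht => Da_w s a t ha ht)
              (is_derive_wA_b s a b ha hb)).
assert (Db (Db (w_fun s)) a b = wAA s b a) as ->
  by exact (Derive_positive_ext _ _ _ _ hb (fun t ht => Db_w s a t ha ht)
              (is_derive_wA_a s b a hb ha)).
reflexivity.
Qed.

Lemma alpha_w (s a b : R) :
  -1 < s < 0 -> 0 < a -> 0 < b -> a <> b ->
  alpha (w_fun s) a b = b * wP s a b / (a * wP s b a).
Proof.
intros hs ha hb hab; unfold alpha; rewrite Da_w, Db_w by auto.
assert (hQ := wP_pos s b a hs hb ha).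
assert (hK := Rpower_pos (a * b) (s - 2)).
unfold wA; rewrite (Rmult_comm b a), (Rplus_comm b a).
field; repeat split; lra.
Qed.

(** The three lines on the left are the three terms of E_w, cleared of denominators and of the
    common factor shown in [Ew_closed_form]; the sum is divisible by (a + b)^2. *)
Lemma wE_factor (s a b : R) :
  - (1 - s) * ((a - b) * wP s a b) * (a * wP s b a + b * wP s a b) ^ 2
  - a * (wTaa s a b * wP s b a ^ 2 + 2 * wTab s a b * wP s a b * wP s b a
         + wTaa s b a * wP s a b ^ 2)
  - 2 * (a + b) * b * wP s a b ^ 2 * (a * wP s b a + b * wP s a b)
  = (a + b) ^ 2 * wE s a b.
Proof. unfold wTaa, wTab, wP, wE; ring. Qed.

Lemma Ew_closed_form (s a b : R) :
  -1 < s < 0 -> 0 < a -> 0 < b -> a <> b ->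
  Ew (vF s) (w_fun s) a b
  = - s * Rpower (a + b) (s - 2) * Rpower (a * b) (s - 2)
    / (a ^ 3 * wP s b a ^ 2) * wE s a b.
Proof.
intros hs ha hb hab.
assert (hQ := wP_pos s b a hs hb ha).
replace (wE s a b) with ((a + b) ^ 2 * wE s a b / (a + b) ^ 2) by (field; lra).
rewrite <- wE_factor; unfold Ew.
destruct (F_derivatives s a b ha hb) as (-> & -> & hF).
rewrite hF, second_order_w, alpha_w, Da_w, Db_w by auto.
unfold wA, wAA, wAB; rewrite (Rmult_comm b a), (Rplus_comm b a).
(* With the polynomials made opaque, the identity is rational in a few atoms and nothing of degree
   15 gets expanded. *)
generalize dependent (wP s b a); intros Q hQ.
generalize (wP s a b) (wTaa s a b) (wTab s a b) (wTaa s b a); intros.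
field; repeat split; lra.
Qed.

Lemma Gw_Ew (s a b : R) :
  -1 < s < 0 -> 0 < a -> 0 < b -> a <> b ->
  Gw (vF s) (w_fun s) a b = Ew (vF s) (w_fun s) b a.
Proof.
intros hs ha hb hab; assert (hba : b <> a) by auto.
assert (hP := wP_pos s a b hs ha hb); assert (hQ := wP_pos s b a hs hb ha).
unfold Gw, Ew.
destruct (F_derivatives s a b ha hb) as (-> & -> & hF).
destruct (F_derivatives s b a hb ha) as (-> & -> & hF').
rewrite hF, hF', !second_order_w, !alpha_w, !Da_w, !Db_w by auto.
(* Equality of the mixed partials matches the cross terms of the two second-order forms. *)
rewrite (wAB_sym s b a), (Rplus_comm b a) by auto.
generalize dependent (wP s b a); intros Q hQ.
generalize dependent (wP s a b); intros P hP.
field; repeat split; lra.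
Qed.

(** One factor a - b comes from w_a and w_b; the other appears because the two remaining products
    enter with opposite signs and agree at a = b. *)
Lemma Cw_closed_form (s a b : R) :
  0 < a -> 0 < b ->
  Cw (vF s) (w_fun s) a b
  = Rpower (a + b) (s - 2) * Rpower (a * b) (s - 2) / (a + b) * (a - b) ^ 2
    * ((-1 + s - s ^ 2) * (a ^ 5 + b ^ 5)
       + (-3 + s + s ^ 2) * (a ^ 4 * b + a * b ^ 4)
       - 2 * s * (a ^ 3 * b ^ 2 + a ^ 2 * b ^ 3)).
Proof.
intros ha hb; unfold Cw.
destruct (F_derivatives s a b ha hb) as (-> & -> & _).
rewrite Da_w, Db_w by auto.
replace (vF s a b) with (- ((a + b) ^ 2 * Rpower (a + b) (s - 2))).
2: { unfold vF; replace (s - 2) with (s - 1 - 1) by ring.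
     rewrite !Rpower_sub1 by lra; field; lra. }
unfold wA, wP; rewrite (Rmult_comm b a), (Rplus_comm b a).
field; lra.
Qed.

(** * Regularity of w and F *)

Lemma w_C2 (s : R) : C2_quadrant (w_fun s).
Proof.
apply C2_quadrant_intro with
  (wA s) (fun a b => wA s b a)
  (wAA s) (wAB s) (fun a b => wAB s b a) (fun a b => wAA s b a);
  intros a b ha hb.
- split; [now apply is_derive_w_a | split; [now apply is_derive_w_b | ]].
  split; [now apply is_derive_wA_a | split; [now apply is_derive_wA_b | ]].
  split; [now apply is_derive_wA_b | now apply is_derive_wA_a].
- assert (hab : 0 < a * b) by now apply Rmult_lt_0_compat.
  assert (hba : 0 < b * a) by now apply Rmult_lt_0_compat.
  unfold w_fun, wA, wAA, wAB, wTaa, wTab, wP.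
  repeat match goal with |- _ /\ _ => split end; continuity_2d; auto;
  apply Rgt_not_eq; repeat apply Rmult_lt_0_compat; try apply pow_lt; lra.
Qed.

Lemma F_C2 (s : R) : C2_quadrant (vF s).
Proof.
unfold vF.
apply C2_quadrant_intro with
  (fun a b => - s * Rpower (a + b) (s - 1))
  (fun a b => - s * Rpower (a + b) (s - 1))
  (fun a b => s * (1 - s) * Rpower (a + b) (s - 2))
  (fun a b => s * (1 - s) * Rpower (a + b) (s - 2))
  (fun a b => s * (1 - s) * Rpower (a + b) (s - 2))
  (fun a b => s * (1 - s) * Rpower (a + b) (s - 2)); intros a b ha hb.
- destruct (is_derive_F s a b ha hb) as (? & ? & ? & ?).
  repeat match goal with |- _ /\ _ => split end; assumption.
- repeat match goal with |- _ /\ _ => split end; continuity_2d; lra.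
Qed.

(** * Behaviour of alpha and its derivative near rho = 0 *)

(** Turns an o(1 / x) estimate into the evaluation at 0 of a continuous function. The identity is
    asked only for x < 1 because the formula for [alpha] at (x, 1) excludes the diagonal. *)
Lemma eq_up_to_o_inv_intro (f g h : R -> R) :
  (forall x, 0 < x < 1 -> f x - g x = h x / x) ->
  continuity_pt h 0 -> h 0 = 0 -> eq_up_to_o_inv f g.
Proof.
intros e hc h0 eps.
destruct (hc eps (cond_pos eps)) as (d & hd & near).
exists (mkposreal _ (Rmin_pos _ _ hd Rlt_0_1)); intros x hx x0.
pose proof (Rmin_l d 1); pose proof (Rmin_r d 1).
change (Rabs (x - 0) < Rmin d 1) in hx; apply Rabs_def2 in hx.
unfold norm; simpl; unfold abs; simpl.
rewrite e by lra; unfold Rdiv; rewrite Rabs_mult.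
apply Rmult_le_compat_r; [apply Rabs_pos | ].
replace (h x) with (h x - h 0) by lra.
apply Rlt_le, (near x); split.
- split; [exact I | lra].
- change (Rabs (x - 0) < d); apply Rabs_def1; lra.
Qed.

(* With [p x = wP s x 1], [q x = wP s 1 x] and [c = p 0 / q 0], the function
   [alpha_rem] is [(p - c q) / x]. *)
Definition alpha_rem (s x : R) : R :=
  3 - x + 3 * x ^ 2 + (1 + s) * x ^ 3
  - (2 - s) / (1 + s) * (3 - x + 3 * x ^ 2 + (2 - s) * x ^ 3).

(** [dP] and [dQ] are the derivatives of p and q. *)
Definition dP (s x : R) : R := 4 * (1 + s) * x ^ 3 + 9 * x ^ 2 - 2 * x + 3.
Definition dQ (s x : R) : R := 4 * (2 - s) * x ^ 3 + 9 * x ^ 2 - 2 * x + 3.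

Lemma wP_diff (s x : R) :
  1 + s <> 0 ->
  wP s x 1 = (2 - s) / (1 + s) * wP s 1 x + x * alpha_rem s x.
Proof. intros; unfold wP, alpha_rem; field; auto. Qed.

(** Since alpha = p / (x q), the difference alpha - c / x is [alpha_rem] / q, which stays
    bounded. *)
Lemma alpha_w_asymptotics (s : R) :
  -1 < s < 0 ->
  eq_up_to_o_inv (fun x => alpha (w_fun s) x 1)
    (fun x => (2 - s) / (1 + s) / x).
Proof.
intros hs.
apply eq_up_to_o_inv_intro with (fun x => x * alpha_rem s x / wP s 1 x).
- intros x hx; assert (hQ := wP_pos s 1 x hs Rlt_0_1 (proj1 hx)).
  rewrite alpha_w, wP_diff by lra.
  generalize dependent (wP s 1 x); intros Q hQ.
  field; repeat split; lra.
- unfold alpha_rem, wP; reg; lra.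
- unfold Rdiv; ring.
Qed.

(** Adding c / x^2 to the derivative of p / (x q) cancels the double pole. The residue at the simple
    pole vanishes because q(0) [alpha_rem](0) = p'(0) q(0) - p(0) q'(0). *)
Lemma alpha_w_a_asymptotics (s : R) :
  -1 < s < 0 ->
  eq_up_to_o_inv (fun x => Da (alpha (w_fun s)) x 1)
    (fun x => - ((2 - s) / (1 + s) / x ^ 2)).
Proof.
intros hs.
apply eq_up_to_o_inv_intro with (fun x =>
  (dP s x * wP s 1 x - wP s x 1 * dQ s x - wP s 1 x * alpha_rem s x)
  / wP s 1 x ^ 2).
- intros x hx; assert (hQ := wP_pos s 1 x hs Rlt_0_1 (proj1 hx)).
  assert (Da (alpha (w_fun s)) x 1
    = (dP s x * (x * wP s 1 x) - wP s x 1 * (wP s 1 x + x * dQ s x))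
      / (x * wP s 1 x) ^ 2) as ->.
  { apply is_derive_unique.
    apply is_derive_ext_loc with (fun t => wP s t 1 / (t * wP s 1 t)).
    - apply (locally_interval _ x 0 1); simpl; try lra.
      intros t h0 h1; rewrite alpha_w by lra; unfold Rdiv; ring.
    - assert (n0 : x * wP s 1 x <> 0)
        by (apply Rgt_not_eq, Rmult_lt_0_compat; lra).
      assert (hp : is_derive (fun t => wP s t 1) x (dP s x))
        by (unfold wP, dP; auto_derive; auto; ring).
      assert (hq : is_derive (fun t => t * wP s 1 t) x (wP s 1 x + x * dQ s x))
        by (unfold wP, dQ; auto_derive; auto; ring).
      exact (is_derive_div _ _ _ _ _ hp hq n0). }
  rewrite (wP_diff s x) by lra.
  generalize dependent (wP s 1 x); intros Q hQ.
  field; repeat split; lra.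
- assert (hQ : wP s 1 0 <> 0) by (unfold wP; lra).
  pose proof (pow_nonzero _ 2 hQ).
  unfold alpha_rem, dP, dQ; unfold wP in *; reg; assumption.
- unfold alpha_rem, wP, dP, dQ; field; lra.
Qed.

(** * Verification of the MPF conditions *)

Theorem lemma8p5 (sigma : R) (hsigma : -1 < sigma < 0) :
  is_MPF
    (fun a b : R => - Rpower (a + b) sigma)
    (fun a b : R =>
       (a - b) ^ 2 * (a ^ 2 + b ^ 2) * Rpower (a * b) (sigma - 2) / (a + b)).
Proof.
change (is_MPF (vF sigma) (w_fun sigma)); set (s := sigma) in *.
(* F is negative, so the clauses for contracting velocities hold vacuously. *)
assert (not_contracting : ~ contracting (vF s)).
{ intros h; specialize (h 1 1 Rlt_0_1 Rlt_0_1).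
  pose proof (Rpower_pos (1 + 1) s); unfold vF in h; lra. }
assert (pw : forall a b, 0 < a -> 0 < b ->
  exists k, 0 < k /\ wA s a b = (a - b) * k).
{ intros a b ha hb; pose proof (wP_pos s a b hsigma ha hb).
  exists (Rpower (a * b) (s - 2) * wP s a b / (a * (a + b) ^ 2)); split.
  - apply Rdiv_lt_0_compat; repeat apply Rmult_lt_0_compat; try lra.
    apply Rpower_pos.
  - unfold wA; field; lra. }
assert (hE : forall a b, 0 < a -> 0 < b -> a <> b ->
  Ew (vF s) (w_fun s) a b <= 0).
{ intros a b ha hb hab; rewrite Ew_closed_form by auto.
  pose proof (wP_pos s b a hsigma hb ha).
  pose proof (wE_nonpos s a b hsigma ha hb).
  assert (0 < - s * Rpower (a + b) (s - 2) * Rpower (a * b) (s - 2)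
              / (a ^ 3 * wP s b a ^ 2)).
  { apply Rdiv_lt_0_compat; repeat apply Rmult_lt_0_compat;
      try apply Rpower_pos; lra. }
  nra. }
constructor.
- split; [apply F_C2 | split; [ | split]].
  + intros a b _ _; unfold vF; now rewrite Rplus_comm.
  + exists s; split; [lra | ]; intros t a b ht ha hb; unfold vF.
    rewrite <- Rmult_plus_distr_l, <- Rpower_mult_distr by lra; ring.
  + intros a b ha hb; destruct (F_derivatives s a b ha hb) as (-> & -> & _).
    assert (0 < - s * ((a + b) * Rpower (a + b) (s - 2))).
    { repeat apply Rmult_lt_0_compat; try apply Rpower_pos; lra. }
    auto.
- apply w_C2.
- intros a b _ _; apply w_fun_sym.
- exists (2 * s - 1); repeat split; try lra; try tauto.
  intros t a b ht ha hb; unfold w_fun.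
  replace (t * a * (t * b)) with (t * (t * (a * b))) by ring.
  assert (0 < a * b) by now apply Rmult_lt_0_compat.
  rewrite <- !Rpower_mult_distr by (try apply Rmult_lt_0_compat; auto).
  (* The power of a b contributes s - 2 twice; the rational factor of w has degree 2 + 2 - 1 = 3. *)
  replace (2 * s - 1) with ((s - 2) + (s - 2) + INR 3) by (simpl; ring).
  rewrite !Rpower_plus, Rpower_pow by auto.
  rewrite <- (Rmult_plus_distr_l t a b).
  field; lra.
- intros a b ha hb hab; unfold w_fun; apply Rdiv_lt_0_compat; [ | lra].
  assert (0 < (a - b) ^ 2) by (apply pow2_gt_0; lra).
  apply Rmult_lt_0_compat; [ | apply Rpower_pos].
  apply Rmult_lt_0_compat; auto; nra.
- intros a ha; unfold w_fun; field; lra.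
- intros a b ha hab; rewrite Da_w by lra.
  destruct (pw a b) as (k & hk & ->); nra.
- intros a b hb hab; rewrite Da_w by lra.
  destruct (pw a b) as (k & hk & ->); nra.
- intros a b ha hb; rewrite Cw_closed_form by auto.
  match goal with |- ?u * ?v <= 0 => assert (hu : 0 <= u); [ | assert (v <= 0)] end.
  + apply Rmult_le_pos; [ | apply pow2_ge_0].
    apply Rlt_le, Rdiv_lt_0_compat; [ | lra].
    apply Rmult_lt_0_compat; apply Rpower_pos.
  + assert (h5 : 0 < a ^ 5 + b ^ 5)
      by (apply Rplus_lt_0_compat; now apply pow_lt).
    (* This product is the difference of the two sides of [h4]. *)
    assert (h : 0 <= a * b * ((a + b) * (a - b) ^ 2)).
    { apply Rmult_le_pos; [nra | ].
      apply Rmult_le_pos; [lra | apply pow2_ge_0]. }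
    assert (h3 : 0 < a ^ 3 * b ^ 2 + a ^ 2 * b ^ 3)
      by (apply Rplus_lt_0_compat; apply Rmult_lt_0_compat; now apply pow_lt).
    assert (h4 : a ^ 3 * b ^ 2 + a ^ 2 * b ^ 3 <= a ^ 4 * b + a * b ^ 4) by lra.
    generalize dependent (a ^ 5 + b ^ 5).
    generalize dependent (a ^ 4 * b + a * b ^ 4).
    generalize dependent (a ^ 3 * b ^ 2 + a ^ 2 * b ^ 3); intros m3 h3 m4 h4 m5 h5.
    (* The coefficient of [m4] is -(1 - s - s^2) - 2; as [m3] <= [m4], the part -2 [m4] combines
       with -2 s [m3] into at most -(2 + 2 s) [m3]. *)
    assert (0 <= (1 - s + s ^ 2) * m5) by (apply Rmult_le_pos; nra).
    assert (0 <= (1 - s - s ^ 2) * m4) by (apply Rmult_le_pos; nra).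
    assert (0 <= (2 + 2 * s) * m3) by (apply Rmult_le_pos; lra).
    lra.
  + nra.
- exact hE.
- intros a b ha hb hab; rewrite Gw_Ew by auto; apply hE; auto.
- exists ((2 - s) / (1 + s)), 0; split; [apply Rdiv_lt_0_compat; lra | ].
  split; [tauto | intros _; left; split].
  + now apply alpha_w_asymptotics.
  + now apply alpha_w_a_asymptotics.
Qed.
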